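(* Let $B$ be a bialgebra in the braided monoidal category $\mathcal{B}$ and let $A$ be a right $B$-module algebra in $\mathcal{B}$, with right $B$-action $b_A\colon A\otimes B\to A$. Let $(V,b_V,\delta_V)$ be a right Yetter--Drinfeld module over $B$ in $\mathcal{B}$ (right action $b_V\colon V\otimes B\to V$, right coaction $\delta_V\colon V\to V\otimes B$), and let $(W,a_W,b_W)$ be an object of $A\text{-}\mathbf{Mod}(\mathbf{Mod}\text{-}B)$, where $a_W\colon A\otimes W\to W$ and $b_W\colon W\otimes B\to W$ are the $A$-action and the $B$-action. Then $V\otimes W$ becomes an object $V\triangleright W$ of $A\text{-}\mathbf{Mod}(\mathbf{Mod}\text{-}B)$ with $A$-action $a_{V\triangleright W}$ and $B$-action $b_{V\triangleright W}$ given by $$a_{V\triangleright W}:=(\mathrm{Id}_{V}\otimes a_W)(\mathrm{Id}_{V}\otimes b_A\otimes \mathrm{Id}_W)(\Psi_{A,V}\otimes \mathrm{Id}_{B\otimes W})(\mathrm{Id}_A\otimes \delta_V\otimes \mathrm{Id}_W),$$ $$b_{V\triangleright W}:=(b_V\otimes b_W)(\mathrm{Id}_V\otimes \Psi_{W,B}\otimes \mathrm{Id}_B)(\mathrm{Id}_{V\otimes W}\otimes \Delta).$$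
   Context: $\Bbbk$ is a field and $\mathcal{B}$ is a $\Bbbk$-linear braided monoidal category with unit object $I$ and braiding $\Psi$ (associativity and unit isomorphisms are suppressed). A bialgebra $B$ in $\mathcal{B}$ is an object with an associative unital algebra structure $(m_B,1_B)$ and a coassociative counital coalgebra structure $(\Delta,\varepsilon)$, all maps in $\mathcal{B}$, such that $\Delta m_B=(m_B\otimes m_B)(\mathrm{Id}_B\otimes\Psi_{B,B}\otimes \mathrm{Id}_B)(\Delta\otimes\Delta)$, $\Delta 1_B=1_B\otimes 1_B$, $\varepsilon m_B=\varepsilon\otimes\varepsilon$ and $\varepsilon 1_B=\mathrm{Id}_I$. All modules and comodules are objects in $\mathcal{B}$ with structure maps in $\mathcal{B}$. The tensor product of right $B$-modules $(X,b_X),(Y,b_Y)$ has action $b_{X\otimes Y}=(b_X\otimes b_Y)(\mathrm{Id}_X\otimes\Psi_{Y,B}\otimes\mathrm{Id}_B)(\mathrm{Id}_{X\otimes Y}\otimes\Delta)$. A right $B$-module algebra is an algebra $(A,m_A,1_A)$ in $\mathcal{B}$ with a right $B$-action $b_A$ such that $b_A(m_A\otimes\mathrm{Id}_B)=m_A b_{A\otimes A}$ and $b_A(1_A\otimes\mathrm{Id}_B)=1_A\varepsilon$. $A\text{-}\mathbf{Mod}(\mathbf{Mod}\text{-}B)$ is the category of objects $W$ with a left $A$-action $a_W$ and a right $B$-action $b_W$ such that $a_W$ is a morphism of right $B$-modules, i.e. $b_W(a_W\otimes \mathrm{Id}_B)=a_W b_{A\otimes W}$. A right Yetter--Drinfeld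 module over $B$ in $\mathcal{B}$ is an object $V$ with a right $B$-action $b\colon V\otimes B\to V$ and a right $B$-coaction $\delta\colon V\to V\otimes B$ such that $$(b\otimes m_B)(\mathrm{Id}_V\otimes\Psi_{B,B}\otimes\mathrm{Id}_B)(\delta\otimes\Delta)=(\mathrm{Id}_V\otimes m_B)(\Psi_{B,V}\otimes\mathrm{Id}_B)(\mathrm{Id}_B\otimes\delta b)(\Psi_{V,B}\otimes\mathrm{Id}_B)(\mathrm{Id}_V\otimes\Delta).$$ *)

(* Defs.v *)
From HB Require Import structures.
From mathcomp Require Import all_boot all_algebra.

Set Implicit Arguments.
Unset Strict Implicit.
Unset Printing Implicit Defensive.

Import GRing.Theory.
Local Open Scope ring_scope.

Declare Scope bmc_scope.
Delimit Scope bmc_scope with bmc.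

Reserved Notation "g ∘ f" (at level 60, right associativity).
Reserved Notation "X ⊗ Y" (at level 40, left associativity).
Reserved Notation "f ⊠ g" (at level 40, left associativity).

(* Categories enriched over the category of vector spaces over k. *)
Record linearCategory (k : fieldType) : Type := LinearCategory {
  obj :> Type;
  hom : obj -> obj -> lmodType k;
  idm : forall X, hom X X;
  comp : forall X Y Z, hom Y Z -> hom X Y -> hom X Z
    where "g ∘ f" := (comp g f);
  comp_idl : forall X Y (f : hom X Y), idm Y ∘ f = f;
  comp_idr : forall X Y (f : hom X Y), f ∘ idm X = f;
  comp_assoc : forall X Y Z T (h : hom Z T) (g : hom Y Z) (f : hom X Y),
    h ∘ (g ∘ f) = (h ∘ g) ∘ f;
  comp_linl : forall X Y Z (f : hom X Y), linear (fun g : hom Y Z => g ∘ f);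
  comp_linr : forall X Y Z (g : hom Y Z), linear (fun f : hom X Y => g ∘ f)
}.

Arguments hom {k C} X Y : rename.
Arguments idm {k C} X : rename.
Arguments comp {k C X Y Z} g f : rename.
Notation "g ∘ f" := (comp g f) : bmc_scope.
Local Open Scope bmc_scope.

Definition inverse_isos (k : fieldType) (C : linearCategory k) (X Y : C)
    (f : hom X Y) (g : hom Y X) : Prop :=
  g ∘ f = idm X /\ f ∘ g = idm Y.

(* The monoidal structure is not assumed strict: associators and unitors are
   explicit.  X ⊗ Y is the tensor product of objects, f ⊠ g that of morphisms. *)
Record monoidalCategory (k : fieldType) : Type := MonoidalCategory {
  mon_cat :> linearCategory k;
  munit : mon_cat;
  tens : mon_cat -> mon_cat -> mon_cat
    where "X ⊗ Y" := (tens X Y);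
  tensm : forall X X' Y Y' : mon_cat,
    hom X X' -> hom Y Y' -> hom (X ⊗ Y) (X' ⊗ Y')
    where "f ⊠ g" := (tensm f g);
  assoc : forall X Y Z, hom ((X ⊗ Y) ⊗ Z) (X ⊗ (Y ⊗ Z));
  associ : forall X Y Z, hom (X ⊗ (Y ⊗ Z)) ((X ⊗ Y) ⊗ Z);
  lunit : forall X, hom (munit ⊗ X) X;
  luniti : forall X, hom X (munit ⊗ X);
  runit : forall X, hom (X ⊗ munit) X;
  runiti : forall X, hom X (X ⊗ munit);
  tensm_id : forall X Y, idm X ⊠ idm Y = idm (X ⊗ Y);
  tensm_comp : forall X X' X'' Y Y' Y'' (f' : hom X' X'') (f : hom X X')
      (g' : hom Y' Y'') (g : hom Y Y'),
    (f' ∘ f) ⊠ (g' ∘ g) = (f' ⊠ g') ∘ (f ⊠ g);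
  tensm_linl : forall X X' Y Y' (g : hom Y Y'),
    linear (fun f : hom X X' => f ⊠ g);
  tensm_linr : forall X X' Y Y' (f : hom X X'),
    linear (fun g : hom Y Y' => f ⊠ g);
  assoc_iso : forall X Y Z, inverse_isos (assoc X Y Z) (associ X Y Z);
  lunit_iso : forall X, inverse_isos (lunit X) (luniti X);
  runit_iso : forall X, inverse_isos (runit X) (runiti X);
  assoc_nat : forall X X' Y Y' Z Z' (f : hom X X') (g : hom Y Y') (h : hom Z Z'),
    assoc X' Y' Z' ∘ ((f ⊠ g) ⊠ h) = (f ⊠ (g ⊠ h)) ∘ assoc X Y Z;
  lunit_nat : forall X X' (f : hom X X'),
    lunit X' ∘ (idm munit ⊠ f) = f ∘ lunit X;
  runit_nat : forall X X' (f : hom X X'),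
    runit X' ∘ (f ⊠ idm munit) = f ∘ runit X;
  pentagon : forall X Y Z T,
    assoc X Y (Z ⊗ T) ∘ assoc (X ⊗ Y) Z T =
    (idm X ⊠ assoc Y Z T) ∘ assoc X (Y ⊗ Z) T ∘ (assoc X Y Z ⊠ idm T);
  triangle : forall X Y,
    (idm X ⊠ lunit Y) ∘ assoc X munit Y = runit X ⊠ idm Y
}.

Arguments munit {k C} : rename.
Arguments tens {k C} X Y : rename.
Arguments tensm {k C X X' Y Y'} f g : rename.
Arguments assoc {k C} X Y Z : rename.
Arguments associ {k C} X Y Z : rename.
Arguments lunit {k C} X : rename.
Arguments luniti {k C} X : rename.
Arguments runit {k C} X : rename.
Arguments runiti {k C} X : rename.
Notation "X ⊗ Y" := (tens X Y) : bmc_scope.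
Notation "f ⊠ g" := (tensm f g) : bmc_scope.

Record braidedCategory (k : fieldType) : Type := BraidedCategory {
  br_mon :> monoidalCategory k;
  braid : forall X Y : br_mon, hom (X ⊗ Y) (Y ⊗ X);
  braidi : forall X Y : br_mon, hom (Y ⊗ X) (X ⊗ Y);
  braid_iso : forall X Y, inverse_isos (braid X Y) (braidi X Y);
  braid_nat : forall (X X' Y Y' : br_mon) (f : hom X X') (g : hom Y Y'),
    braid X' Y' ∘ (f ⊠ g) = (g ⊠ f) ∘ braid X Y;
  hexagon_r : forall X Y Z : br_mon,
    assoc Y Z X ∘ braid X (Y ⊗ Z) ∘ assoc X Y Z =
    (idm Y ⊠ braid X Z) ∘ assoc Y X Z ∘ (braid X Y ⊠ idm Z);
  hexagon_l : forall X Y Z : br_mon,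
    associ Z X Y ∘ braid (X ⊗ Y) Z ∘ associ X Y Z =
    (braid X Z ⊠ idm Y) ∘ associ X Z Y ∘ (idm X ⊠ braid Y Z)
}.

Arguments braid {k C} X Y : rename.
Arguments braidi {k C} X Y : rename.

(* Id_X ⊗ Ψ_{Y,Z} ⊗ Id_T. *)
Definition mid_braid (k : fieldType) (C : braidedCategory k) (X Y Z T : C) :
    hom ((X ⊗ Y) ⊗ (Z ⊗ T)) ((X ⊗ Z) ⊗ (Y ⊗ T)) :=
  associ X Z (Y ⊗ T)
  ∘ (idm X ⊠ (assoc Z Y T ∘ (braid Y Z ⊠ idm T) ∘ associ Y Z T))
  ∘ assoc X Y (Z ⊗ T).

Record is_algebra (k : fieldType) (C : monoidalCategory k) (A : C)
    (m : hom (A ⊗ A) A) (u : hom munit A) : Prop := IsAlgebra {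
  alg_assoc : m ∘ (m ⊠ idm A) = m ∘ (idm A ⊠ m) ∘ assoc A A A;
  alg_unitl : m ∘ (u ⊠ idm A) = lunit A;
  alg_unitr : m ∘ (idm A ⊠ u) = runit A
}.

Record is_coalgebra (k : fieldType) (C : monoidalCategory k) (B : C)
    (d : hom B (B ⊗ B)) (e : hom B munit) : Prop := IsCoalgebra {
  coalg_coassoc : assoc B B B ∘ (d ⊠ idm B) ∘ d = (idm B ⊠ d) ∘ d;
  coalg_counitl : (e ⊠ idm B) ∘ d = luniti B;
  coalg_counitr : (idm B ⊠ e) ∘ d = runiti B
}.

Record bialgebra (k : fieldType) (C : braidedCategory k) : Type := Bialgebra {
  bi_obj :> C;
  bi_mul : hom (bi_obj ⊗ bi_obj) bi_obj;
  bi_unit : hom munit bi_obj;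
  bi_comul : hom bi_obj (bi_obj ⊗ bi_obj);
  bi_counit : hom bi_obj munit;
  bi_alg : is_algebra bi_mul bi_unit;
  bi_coalg : is_coalgebra bi_comul bi_counit;
  bi_comul_mul : bi_comul ∘ bi_mul =
    (bi_mul ⊠ bi_mul) ∘ mid_braid bi_obj bi_obj bi_obj bi_obj
    ∘ (bi_comul ⊠ bi_comul);
  bi_comul_unit : bi_comul ∘ bi_unit = (bi_unit ⊠ bi_unit) ∘ luniti munit;
  bi_counit_mul : bi_counit ∘ bi_mul = lunit munit ∘ (bi_counit ⊠ bi_counit);
  bi_counit_unit : bi_counit ∘ bi_unit = idm munit
}.

Record is_left_module (k : fieldType) (C : monoidalCategory k) (A : C)
    (m : hom (A ⊗ A) A) (u : hom munit A) (W : C) (a : hom (A ⊗ W) W) :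
    Prop := IsLeftModule {
  lmodule_assoc : a ∘ (m ⊠ idm W) = a ∘ (idm A ⊠ a) ∘ assoc A A W;
  lmodule_unit : a ∘ (u ⊠ idm W) = lunit W
}.

Record is_right_module (k : fieldType) (C : braidedCategory k)
    (B : bialgebra C) (X : C) (b : hom (X ⊗ B) X) : Prop := IsRightModule {
  rmodule_assoc : b ∘ (b ⊠ idm B) = b ∘ (idm X ⊠ bi_mul B) ∘ assoc X B B;
  rmodule_unit : b ∘ (idm X ⊠ bi_unit B) = runit X
}.

Record is_right_comodule (k : fieldType) (C : braidedCategory k)
    (B : bialgebra C) (X : C) (d : hom X (X ⊗ B)) : Prop := IsRightComodule {
  rcomodule_coassoc :
    assoc X B B ∘ (d ⊠ idm B) ∘ d = (idm X ⊠ bi_comul B) ∘ d;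
  rcomodule_counit : (idm X ⊠ bi_counit B) ∘ d = runiti X
}.

Definition is_right_module_morphism (k : fieldType) (C : braidedCategory k)
    (B : bialgebra C) (X Y : C) (bX : hom (X ⊗ B) X) (bY : hom (Y ⊗ B) Y)
    (f : hom X Y) : Prop :=
  bY ∘ (f ⊠ idm B) = f ∘ bX.

Definition tensor_action (k : fieldType) (C : braidedCategory k)
    (B : bialgebra C) (X Y : C) (bX : hom (X ⊗ B) X) (bY : hom (Y ⊗ B) Y) :
    hom ((X ⊗ Y) ⊗ B) (X ⊗ Y) :=
  (bX ⊠ bY) ∘ mid_braid X Y B B ∘ (idm (X ⊗ Y) ⊠ bi_comul B).

Record moduleAlgebra (k : fieldType) (C : braidedCategory k)
    (B : bialgebra C) : Type := ModuleAlgebra {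
  ma_obj :> C;
  ma_mul : hom (ma_obj ⊗ ma_obj) ma_obj;
  ma_unit : hom munit ma_obj;
  ma_act : hom (ma_obj ⊗ B) ma_obj;
  ma_alg : is_algebra ma_mul ma_unit;
  ma_mod : is_right_module ma_act;
  ma_act_mul :
    ma_act ∘ (ma_mul ⊠ idm B) = ma_mul ∘ tensor_action ma_act ma_act;
  ma_act_unit :
    ma_act ∘ (ma_unit ⊠ idm B) = ma_unit ∘ bi_counit B ∘ lunit B
}.

(* (W, a, b) is an object of A-Mod(Mod-B). *)
Record is_AModModB (k : fieldType) (C : braidedCategory k) (B : bialgebra C)
    (A : moduleAlgebra B) (W : C) (a : hom (A ⊗ W) W) (b : hom (W ⊗ B) W) :
    Prop := IsAModModB {
  amb_left : is_left_module (ma_mul A) (ma_unit A) a;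
  amb_right : is_right_module b;
  amb_compat : is_right_module_morphism (tensor_action (ma_act A) b) b a
}.

Record AModModB (k : fieldType) (C : braidedCategory k) (B : bialgebra C)
    (A : moduleAlgebra B) : Type := MkAModModB {
  amb_obj :> C;
  amb_lact : hom (A ⊗ amb_obj) amb_obj;
  amb_ract : hom (amb_obj ⊗ B) amb_obj;
  amb_ax : is_AModModB amb_lact amb_ract
}.

Record yetterDrinfeldModule (k : fieldType) (C : braidedCategory k)
    (B : bialgebra C) : Type := YetterDrinfeldModule {
  yd_obj :> C;
  yd_act : hom (yd_obj ⊗ B) yd_obj;
  yd_coact : hom yd_obj (yd_obj ⊗ B);
  yd_mod : is_right_module yd_act;
  yd_comod : is_right_comodule yd_coact;
  yd_compat :
    (yd_act ⊠ bi_mul B) ∘ mid_braid yd_obj B B B ∘ (yd_coact ⊠ bi_comul B) =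
    (idm yd_obj ⊠ bi_mul B)
    ∘ assoc yd_obj B B
    ∘ (braid (B : C) yd_obj ⊠ idm B)
    ∘ associ B yd_obj B
    ∘ (idm B ⊠ (yd_coact ∘ yd_act))
    ∘ assoc B yd_obj B
    ∘ (braid yd_obj B ⊠ idm B)
    ∘ associ yd_obj B B
    ∘ (idm yd_obj ⊠ bi_comul B)
}.

Definition triangle_lact (k : fieldType) (C : braidedCategory k)
    (B : bialgebra C) (A : moduleAlgebra B) (V : yetterDrinfeldModule B)
    (W : AModModB A) : hom (A ⊗ (V ⊗ W)) (V ⊗ W) :=
  (idm V ⊠ amb_lact W)
  ∘ (idm V ⊠ (ma_act A ⊠ idm W))
  ∘ (idm V ⊠ associ A B W)
  ∘ assoc V A (B ⊗ W)
  ∘ (braid A V ⊠ idm (B ⊗ W))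
  ∘ associ A V (B ⊗ W)
  ∘ (idm A ⊠ assoc V B W)
  ∘ (idm A ⊠ (yd_coact V ⊠ idm W)).

Definition triangle_ract (k : fieldType) (C : braidedCategory k)
    (B : bialgebra C) (A : moduleAlgebra B) (V : yetterDrinfeldModule B)
    (W : AModModB A) : hom ((V ⊗ W) ⊗ B) (V ⊗ W) :=
  (yd_act V ⊠ amb_ract W)
  ∘ mid_braid V W B B
  ∘ (idm (V ⊗ W) ⊠ bi_comul B).

(* Main.v *)
Require Import Defs.
From HB Require Import structures.
From mathcomp Require Import all_boot all_algebra.
(* Imported again so that hom denotes the hom-spaces of a category rather than a
   type of morphisms between algebraic structures. *)
Require Import Defs.

(** The action of A on V ▷ W factors as
      A ⊗ (V ⊗ W) --psi--> V ⊗ (A ⊗ W) --a_W--> V ⊗ W,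
    where psi : A ⊗ V -> V ⊗ A swaps the two factors by the braiding while the
    coaction of V acts on A: psi (a ⊗ v) = v_(0) ⊗ a · v_(1) in Sweedler notation
    (coact_swap).  Everything follows from two facts about psi.

    First, psi is compatible with the product and unit of A
    (coact_swap_entwining).  This uses that A is a module algebra and that V is a
    comodule, and it makes V ⊗ W an A-module for every A-module W
    (lact_along_module).

    Second, psi is B-linear for the tensor product actions (coact_swap_morphism).
    On a ⊗ v ⊗ c both composites have the form
      v' ⊗ a · b',
    where v' ⊗ b' is v_(0) c_(1) ⊗ v_(1) c_(2) for one of them and
    (v c_(2))_(0) ⊗ c_(1) (v c_(2))_(1) for the other: their equality is the
    Yetter-Drinfeld condition.

    The right B-modules form a monoidal category: a tensor product of modules is a
    module (tensor_action_module), a tensor product of B-linear maps is B-linear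
    (morphism_tens), and the associator is B-linear (morphism_assoc).  So the
    action on V ▷ W is B-linear, being composed of associators, psi ⊗ W and
    V ⊗ a_W.

    The base category is not strict.  An object X is therefore traded for the
    endofunctor R |-> X ⊗ R, and a morphism f : X -> Y for the natural family
    f ⊗ R.  Composition of endofunctors is associative and unital by computation,
    so that in this representation (word, tail) the associators and unitors become
    identities, while a law between morphisms holds as soon as it holds for their
    families (tail_faithful).  A string diagram is then a composite of families
    whiskered on the left, and two drawings of it that differ by the interchange
    law are brought to the same normal form by rewriting with naturality
    (slideE). *)

Set Implicit Arguments.
Unset Strict Implicit.
Unset Printing Implicit Defensive.

Local Open Scope bmc_scope.

HB.lock Definition lwhisk (k : fieldType) (C : monoidalCategory k)
    (X R R' : C) (h : hom R R') : hom (X ⊗ R) (X ⊗ R') := idm X ⊠ h.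

Notation "X ◁ h" := (lwhisk X h) (at level 35, right associativity) : bmc_scope.

(** * Strictification of a monoidal category *)

Section Words.
Variables (k : fieldType) (C : monoidalCategory k).
Implicit Types X Y Z R S T : C.

Lemma tensm_compr X R S T (g : hom S T) (f : hom R S) :
  idm X ⊠ (g ∘ f) = (idm X ⊠ g) ∘ (idm X ⊠ f).
Proof. by rewrite -tensm_comp comp_idl. Qed.

Lemma tensm_rl X X' Y Y' (f : hom X X') (g : hom Y Y') :
  f ⊠ g = (idm X' ⊠ g) ∘ (f ⊠ idm Y).
Proof. by rewrite -tensm_comp comp_idl comp_idr. Qed.

Lemma tensm_lr X X' Y Y' (f : hom X X') (g : hom Y Y') :
  f ⊠ g = (f ⊠ idm Y') ∘ (idm X ⊠ g).
Proof. by rewrite -tensm_comp comp_idl comp_idr. Qed.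

Lemma lwhisk_id X R : X ◁ idm R = idm (X ⊗ R).
Proof. by rewrite lwhisk.unlock tensm_id. Qed.

Lemma lwhisk_comp X R S T (g : hom S T) (f : hom R S) :
  X ◁ (g ∘ f) = X ◁ g ∘ X ◁ f.
Proof. by rewrite lwhisk.unlock tensm_compr. Qed.

Lemma iso_epi X Y Z (f : hom X Y) (fi : hom Y X) (g h : hom Y Z) :
  inverse_isos f fi -> g ∘ f = h ∘ f -> g = h.
Proof.
by case=> _ fK /(congr1 (fun q => q ∘ fi)); rewrite -!comp_assoc fK !comp_idr.
Qed.

Lemma iso_mono X Y Z (f : hom X Y) (fi : hom Y X) (g h : hom Z X) :
  inverse_isos f fi -> f ∘ g = f ∘ h -> g = h.
Proof.
by case=> fK _ /(congr1 (fun q => fi ∘ q)); rewrite !comp_assoc fK !comp_idl.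
Qed.

Lemma inverse_isos_sym X Y (f : hom X Y) g :
  inverse_isos f g -> inverse_isos g f.
Proof. by case. Qed.

Lemma iso_id X : inverse_isos (idm X) (idm X).
Proof. by split; rewrite comp_idl. Qed.

Lemma iso_comp X Y Z (g : hom Y Z) gi (f : hom X Y) fi :
  inverse_isos g gi -> inverse_isos f fi -> inverse_isos (g ∘ f) (fi ∘ gi).
Proof.
move=> [gK gV] [fK fV]; split.
  by rewrite -comp_assoc (comp_assoc gi) gK comp_idl.
by rewrite -comp_assoc (comp_assoc f) fV comp_idl.
Qed.

Lemma iso_tens X X' Y Y' (f : hom X X') fi (g : hom Y Y') gi :
  inverse_isos f fi -> inverse_isos g gi -> inverse_isos (f ⊠ g) (fi ⊠ gi).
Proof.
by move=> [fK fV] [gK gV]; split; rewrite -tensm_comp ?fK ?gK ?fV ?gV tensm_id.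
Qed.

(** Kelly's argument: tensoring with the unit object on the left is faithful, and
    after it the two sides agree by the pentagon for I, I, X, Y and the
    triangle. *)
Lemma lunit_tens X Y : lunit (X ⊗ Y) ∘ assoc munit X Y = lunit X ⊠ idm Y.
Proof.
apply: (iso_epi (lunit_iso _)); rewrite -!lunit_nat; congr (_ ∘ _).
apply: (iso_epi (iso_comp (assoc_iso _ _ _)
  (iso_tens (assoc_iso munit munit X) (iso_id Y)))).
rewrite tensm_compr -!comp_assoc.
rewrite -pentagon comp_assoc triangle -tensm_id -assoc_nat -triangle.
by rewrite -[idm Y in LHS]comp_idl tensm_comp !comp_assoc assoc_nat.
Qed.

(** An object presented as a bracketed tensor word.  It carries the endofunctor
    that tensors by the letters of the word one after the other, and the natural
    isomorphism between this functor and tensoring by the whole object.  Canonical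
    instances find the word from the object.  Only wobj takes part in this search:
    a value of wact does not determine the word. *)
Structure word := Word {
  wobj : C;
  #[canonical=no] wact : C -> C;
  #[canonical=no] wactm : forall R R', hom R R' -> hom (wact R) (wact R');
  #[canonical=no] wto : forall R, hom (wobj ⊗ R) (wact R);
  #[canonical=no] wfrom : forall R, hom (wact R) (wobj ⊗ R);
  wact_id : forall R, wactm (idm R) = idm (wact R);
  wact_comp : forall R S T (g : hom S T) (f : hom R S),
    wactm (g ∘ f) = wactm g ∘ wactm f;
  wiso : forall R, inverse_isos (wto R) (wfrom R);
  wto_nat : forall R R' (h : hom R R'),
    wto R' ∘ (idm wobj ⊠ h) = wactm h ∘ wto R
}.
Arguments wactm w {R R'} h.

Lemma leaf_nat X R R' (h : hom R R') :
  idm (X ⊗ R') ∘ (idm X ⊠ h) = X ◁ h ∘ idm (X ⊗ R).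
Proof. by rewrite lwhisk.unlock comp_idl comp_idr. Qed.

(* A variable as canonical value: any object that is not visibly a tensor product
   or the unit object is a letter. *)
Canonical leaf_word X :=
  @Word X _ (lwhisk X) _ _ (lwhisk_id X) (lwhisk_comp X)
    (fun R => iso_id (X ⊗ R)) (@leaf_nat X).

Canonical munit_word :=
  @Word munit id (fun _ _ h => h) _ _ (fun=> erefl) (fun _ _ _ _ _ => erefl)
    (fun R => lunit_iso R) (fun R R' h => lunit_nat h).

Section Tensor.
Variables t s : word.

Definition tact R := wact t (wact s R).

Definition tactm R R' (h : hom R R') : hom (tact R) (tact R') :=
  wactm t (wactm s h).

Definition tto R : hom ((wobj t ⊗ wobj s) ⊗ R) (tact R) :=
  wto t (wact s R) ∘ ((idm (wobj t) ⊠ wto s R) ∘ assoc (wobj t) (wobj s) R).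

Definition tfrom R : hom (tact R) ((wobj t ⊗ wobj s) ⊗ R) :=
  (associ (wobj t) (wobj s) R ∘ (idm (wobj t) ⊠ wfrom s R))
  ∘ wfrom t (wact s R).

Lemma tact_id R : tactm (idm R) = idm (tact R).
Proof. by rewrite /tactm !wact_id. Qed.

Lemma tact_comp R S T (g : hom S T) (f : hom R S) :
  tactm (g ∘ f) = tactm g ∘ tactm f.
Proof. by rewrite /tactm !wact_comp. Qed.

Lemma tiso R : inverse_isos (tto R) (tfrom R).
Proof.
apply: iso_comp (wiso _ _) (iso_comp (iso_tens (iso_id _) (wiso _ _)) _).
exact: assoc_iso.
Qed.

Lemma tto_nat R R' (h : hom R R') :
  tto R' ∘ (idm (wobj t ⊗ wobj s) ⊠ h) = tactm h ∘ tto R.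
Proof.
rewrite /tto /tactm -tensm_id -!comp_assoc assoc_nat.
rewrite (comp_assoc (_ ⊠ wto s R')) -tensm_compr wto_nat.
by rewrite tensm_compr !comp_assoc wto_nat.
Qed.

Canonical tens_word :=
  @Word (wobj t ⊗ wobj s) _ tactm _ _ tact_id tact_comp tiso tto_nat.

End Tensor.
End Words.

Arguments wactm {k C} w {R R'} h.
Arguments wto {k C} w R.
Arguments wfrom {k C} w R.
Arguments wiso {k C} w R.

(** The component at R of the natural family f ⊗ R, read between the endofunctors
    of the two words.  It is locked to keep simplification and unification from
    looking inside. *)
HB.lock Definition tail (k : fieldType) (C : monoidalCategory k) (t s : word C)
    (f : hom (wobj t) (wobj s)) R : hom (wact t R) (wact s R) :=
  wto s R ∘ (f ⊠ idm R) ∘ wfrom t R.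

Notation "⟦ f ⟧" := (tail f _) (at level 0, format "⟦ f ⟧") : bmc_scope.

Section Tail.
Variables (k : fieldType) (C : monoidalCategory k).
Implicit Types (t s u v : word C) (X Y R S T : C).

Lemma tail_nat t s (f : hom (wobj t) (wobj s)) R R' (h : hom R R') :
  tail f R' ∘ wactm t h = wactm s h ∘ tail f R.
Proof.
rewrite tail.unlock; apply: (iso_epi (wiso t R)).
rewrite -!comp_assoc (proj1 (wiso t R)) comp_idr.
rewrite -wto_nat (comp_assoc (wfrom t R')) (proj1 (wiso t R')) comp_idl.
by rewrite -tensm_lr tensm_rl comp_assoc wto_nat comp_assoc.
Qed.

(** The component at the unit object already determines f. *)
Lemma tail_faithful t s (f g : hom (wobj t) (wobj s)) :
  (forall R, tail f R = tail g R) -> f = g.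
Proof.
move=> /(_ munit); rewrite tail.unlock => /(iso_mono (wiso s _)).
move=> /(iso_epi (inverse_isos_sym (wiso t _))) fg.
by apply: (iso_epi (runit_iso _)); rewrite -!runit_nat fg.
Qed.

Lemma tail_id t R : tail (idm (wobj t)) R = idm (wact t R).
Proof. by rewrite tail.unlock tensm_id comp_idl; case: (wiso t R). Qed.

Lemma tail_comp t s u (g : hom (wobj s) (wobj u)) (f : hom (wobj t) (wobj s))
    R :
  tail (g ∘ f) R = tail g R ∘ tail f R.
Proof.
rewrite tail.unlock -!comp_assoc (comp_assoc (wfrom s R)).
rewrite (proj1 (wiso s R)) comp_idl.
by rewrite -{1}[idm R]comp_idl tensm_comp -!comp_assoc.
Qed.

Lemma tailK t s (f : hom (wobj t) (wobj s)) R :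
  tail f R ∘ wto t R = wto s R ∘ (f ⊠ idm R).
Proof. by rewrite tail.unlock -!comp_assoc (proj1 (wiso t R)) comp_idr. Qed.

Lemma tail_uniq t s (f : hom (wobj t) (wobj s)) R g :
  g ∘ wto t R = wto s R ∘ (f ⊠ idm R) -> tail f R = g.
Proof. by move=> fg; apply: (iso_epi (wiso t R)); rewrite tailK. Qed.

Lemma tail_tens t t' s s' (f : hom (wobj t) (wobj t'))
    (g : hom (wobj s) (wobj s')) R :
  tail (f ⊠ g) R = wactm t' (tail g R) ∘ tail f (wact s R).
Proof.
apply: tail_uniq; rewrite /= /tto.
rewrite -comp_assoc (comp_assoc (tail f _)) tailK -!comp_assoc assoc_nat.
rewrite !(comp_assoc _ _ (assoc _ _ _)) !comp_assoc -wto_nat; congr (_ ∘ _).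
by rewrite -!comp_assoc -!tensm_comp !(comp_idl, comp_idr) tailK.
Qed.

(** The associator becomes an identity: both bracketings of a word have the same
    endofunctor, and the two isomorphisms with it differ by the associator because
    of the pentagon. *)
Lemma tail_assoc t s u R :
  tail (assoc (wobj t) (wobj s) (wobj u)) R = idm (wact t (wact s (wact u R))).
Proof.
apply: tail_uniq; rewrite comp_idl /= /tto /= /tto.
rewrite -!comp_assoc; congr (_ ∘ _).
rewrite -(comp_idl (idm (wobj t))) !tensm_comp -!comp_assoc comp_idl.
congr (_ ∘ _); rewrite tensm_compr -comp_assoc -pentagon.
by rewrite !comp_assoc -assoc_nat tensm_id.
Qed.

Lemma tail_inverse t s (f : hom (wobj t) (wobj s)) g R
    (F : hom (wact t R) (wact s R)) G :
  tail f R = F -> inverse_isos f g -> inverse_isos F G -> tail g R = G.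
Proof.
move=> <- [_ fg] FG; apply: (iso_mono FG).
by rewrite -tail_comp fg tail_id (proj2 FG).
Qed.

Lemma tail_associ t s u R :
  tail (associ (wobj t) (wobj s) (wobj u)) R
  = idm (wact t (wact s (wact u R))).
Proof.
exact: tail_inverse (tail_assoc t s u R) (assoc_iso _ _ _) (iso_id _).
Qed.

Lemma tail_lunit t R : tail (lunit (wobj t)) R = idm (wact t R).
Proof.
apply: tail_uniq; rewrite comp_idl /= /tto /= comp_assoc lunit_nat.
by rewrite -comp_assoc lunit_tens.
Qed.

Lemma tail_luniti t R : tail (luniti (wobj t)) R = idm (wact t R).
Proof. exact: tail_inverse (tail_lunit t R) (lunit_iso _) (iso_id _). Qed.

Lemma tail_runit t R : tail (runit (wobj t)) R = idm (wact t R).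
Proof. by apply: tail_uniq; rewrite comp_idl /= /tto /= triangle. Qed.

Lemma tail_runiti t R : tail (runiti (wobj t)) R = idm (wact t R).
Proof. exact: tail_inverse (tail_runit t R) (runit_iso _) (iso_id _). Qed.

Lemma tail_iso t s f g R : inverse_isos f g ->
  inverse_isos (@tail k C t s f R) (tail g R).
Proof. by case=> fK gK; split; rewrite -tail_comp ?fK ?gK tail_id. Qed.

Lemma wactm_leaf X R S (h : hom R S) : wactm (leaf_word X) h = X ◁ h.
Proof. by []. Qed.

Lemma wactm_munit R S (h : hom R S) : wactm (munit_word C) h = h.
Proof. by []. Qed.

Lemma wactm_tens t s R S (h : hom R S) :
  wactm (tens_word t s) h = wactm t (wactm s h).
Proof. by []. Qed.

End Tail.

Definition tailE := (@tail_comp, @tail_tens, @tail_id, @tail_assoc,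
  @tail_associ, @tail_lunit, @tail_luniti, @tail_runit, @tail_runiti).

Definition wactmE := (wactm_leaf, wactm_munit, wactm_tens).

(** Turns the tail of an expression into a composite of whiskered tails of its
    generators, in which the coherence isomorphisms have disappeared. *)
Ltac strictify := rewrite ?tailE ?wact_id ?wactmE ?lwhisk_id ?comp_idl
  ?comp_idr ?lwhisk_id ?comp_idl ?comp_idr.

(** * Normal forms for the interchange law *)

(** Composites are associated to the right, adjacent whiskerings by the same object
    are merged, and a morphism h that acts only on strands to the right of those of
    a generator f is moved past f, so that it is applied after f.  The lemma slideMN
    does this for a generator with M inputs and N outputs.  The suffix comp is for
    an occurrence inside a longer composite, and the suffix under for h already
    merged with a morphism that does meet f; the list covers the occurrences that
    arise in the diagrams below.  The shapes are stated one by one because a rule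
    whose output word were a variable could not be matched against the simplified
    objects of a goal. *)
Section Slides.
Variables (k : fieldType) (C : monoidalCategory k).

Lemma compA_r (X Y Z T : C) (h : hom Z T) (g : hom Y Z) (f : hom X Y) :
  (h ∘ g) ∘ f = h ∘ g ∘ f.
Proof. by rewrite comp_assoc. Qed.

Lemma merge (X R S T : C) (g : hom S T) (f : hom R S) :
  X ◁ g ∘ X ◁ f = X ◁ (g ∘ f).
Proof. by rewrite lwhisk_comp. Qed.

Lemma merge_comp (X Q R S T : C) (g : hom S T) (f : hom R S)
    (r : hom Q (X ⊗ R)) :
  X ◁ g ∘ X ◁ f ∘ r = X ◁ (g ∘ f) ∘ r.
Proof. by rewrite lwhisk_comp comp_assoc. Qed.

Section Generic.
Variables (X Y : C) (s : word C) (R R' : C) (h : hom R R').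

Lemma slide1_comp (f : hom X (wobj s)) Q (r : hom Q (X ⊗ R)) :
  ⟦f⟧ ∘ X ◁ h ∘ r = wactm s h ∘ ⟦f⟧ ∘ r.
Proof.
rewrite [RHS]comp_assoc -(@tail_nat _ _ (leaf_word X)).
exact: comp_assoc.
Qed.

Lemma slide2_comp (f : hom (X ⊗ Y) (wobj s)) Q (r : hom Q (X ⊗ (Y ⊗ R))) :
  ⟦f⟧ ∘ X ◁ Y ◁ h ∘ r = wactm s h ∘ ⟦f⟧ ∘ r.
Proof.
rewrite [RHS]comp_assoc.
rewrite -(@tail_nat _ _ (tens_word (leaf_word X) (leaf_word Y))).
exact: comp_assoc.
Qed.

Lemma slide2_under_comp (f : hom (X ⊗ Y) (wobj s)) P Q (g : hom Q (Y ⊗ R))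
    (r : hom P (X ⊗ Q)) :
  ⟦f⟧ ∘ X ◁ (Y ◁ h ∘ g) ∘ r = wactm s h ∘ ⟦f⟧ ∘ X ◁ g ∘ r.
Proof. by rewrite lwhisk_comp -[in LHS]comp_assoc slide2_comp. Qed.

End Generic.

Section Shapes.
Variables (X Y Z T P Q R R' : C) (h : hom R R').

Lemma slide01 (f : hom munit Z) :
  ⟦f⟧ ∘ h = Z ◁ h ∘ ⟦f⟧.
Proof. exact: (@tail_nat _ _ (munit_word C) (leaf_word Z)). Qed.

Lemma slide12_comp (f : hom X (Z ⊗ T)) (r : hom Q (X ⊗ R)) :
  ⟦f⟧ ∘ X ◁ h ∘ r = Z ◁ T ◁ h ∘ ⟦f⟧ ∘ r.
Proof.
exact: (slide1_comp (s := tens_word (leaf_word Z) (leaf_word T))).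
Qed.

Lemma slide21 (f : hom (X ⊗ Y) Z) :
  ⟦f⟧ ∘ X ◁ Y ◁ h = Z ◁ h ∘ ⟦f⟧.
Proof.
exact: (@tail_nat _ _ (tens_word (leaf_word X) (leaf_word Y))
  (leaf_word Z)).
Qed.

Lemma slide21_under (f : hom (X ⊗ Y) Z) (g : hom Q (Y ⊗ R)) :
  ⟦f⟧ ∘ X ◁ (Y ◁ h ∘ g) = Z ◁ h ∘ ⟦f⟧ ∘ X ◁ g.
Proof. rewrite lwhisk_comp; exact: (slide2_comp (s := leaf_word Z)). Qed.

Lemma slide21_under_comp (f : hom (X ⊗ Y) Z) (g : hom Q (Y ⊗ R))
    (r : hom P (X ⊗ Q)) :
  ⟦f⟧ ∘ X ◁ (Y ◁ h ∘ g) ∘ r = Z ◁ h ∘ ⟦f⟧ ∘ X ◁ g ∘ r.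
Proof. exact: (slide2_under_comp (s := leaf_word Z)). Qed.

Lemma slide22_under (f : hom (X ⊗ Y) (Z ⊗ T)) (g : hom Q (Y ⊗ R)) :
  ⟦f⟧ ∘ X ◁ (Y ◁ h ∘ g) = Z ◁ T ◁ h ∘ ⟦f⟧ ∘ X ◁ g.
Proof.
rewrite lwhisk_comp.
exact: (slide2_comp (s := tens_word (leaf_word Z) (leaf_word T))).
Qed.

End Shapes.
End Slides.

Definition slideE := (compA_r, merge, merge_comp, slide01, slide12_comp,
  slide21, slide21_under, slide21_under_comp, slide22_under).

Ltac interchange := rewrite /= ?slideE.

(* The new drawing of the left-hand side is chosen so as to bring the generators of
   the next law next to each other, where the law can be rewritten. *)
Tactic Notation "redraw" uconstr(diagram) :=
  refine (@etrans _ _ diagram _ _ _); [by interchange |].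

(** * The braiding in strict form *)

Section Braiding.
Variables (k : fieldType) (C : braidedCategory k).

Section OnWords.
Implicit Types t s u : word C.

Lemma braid_tensl t s u R :
  tail (braid (wobj t ⊗ wobj s) (wobj u)) R
  = tail (braid (wobj t) (wobj u)) (wact s R)
    ∘ wactm t (tail (braid (wobj s) (wobj u)) R).
Proof.
have /(congr1 (fun f => tail f R)) := hexagon_l (wobj t) (wobj s) (wobj u).
by strictify.
Qed.

Lemma braid_tensr t s u R :
  tail (braid (wobj t) (wobj s ⊗ wobj u)) R
  = wactm s (tail (braid (wobj t) (wobj u)) R)
    ∘ tail (braid (wobj t) (wobj s)) (wact u R).
Proof.
have /(congr1 (fun f => tail f R)) := hexagon_r (wobj t) (wobj s) (wobj u).
by strictify.
Qed.

Lemma braid_natl t t' s (f : hom (wobj t) (wobj t')) R :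
  tail (braid (wobj t') (wobj s)) R ∘ tail f (wact s R)
  = wactm s (tail f R) ∘ tail (braid (wobj t) (wobj s)) R.
Proof.
have /(congr1 (fun f => tail f R)) := braid_nat f (idm (wobj s)).
by strictify.
Qed.

Lemma braid_natr t s s' (g : hom (wobj s) (wobj s')) R :
  tail (braid (wobj t) (wobj s')) R ∘ wactm t (tail g R)
  = tail g (wact t R) ∘ tail (braid (wobj t) (wobj s)) R.
Proof.
have /(congr1 (fun f => tail f R)) := braid_nat (idm (wobj t)) g.
by strictify.
Qed.

(** By the hexagon for I ⊗ I and naturality along I ⊗ I -> I, the braiding with the
    unit object is an idempotent, and it is invertible. *)
Lemma braid_unitl t R : tail (braid munit (wobj t)) R = idm (wact t R).
Proof.
have := braid_natl t (lunit munit) R.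
rewrite braid_tensl; strictify => idem.
have iso := tail_iso (t := tens_word (munit_word C) t)
  (s := tens_word t (munit_word C)) R (braid_iso munit (wobj t)).
by apply: (iso_mono iso); rewrite -idem comp_idr.
Qed.

Lemma braid_unitr t R : tail (braid (wobj t) munit) R = idm (wact t R).
Proof.
have := braid_natr t (lunit munit) R.
rewrite braid_tensr; strictify => idem.
have iso := tail_iso (t := tens_word t (munit_word C))
  (s := tens_word (munit_word C) t) R (braid_iso (wobj t) munit).
by apply: (iso_mono iso); rewrite -idem comp_idr.
Qed.

End OnWords.

Section OnLetters.
Variables (X Y Z T R : C).

Lemma braid_mull (f : hom (X ⊗ Y) Z) :
  ⟦braid Z T⟧ ∘ ⟦f⟧ = T ◁ ⟦f⟧ ∘ ⟦braid X T⟧ ∘ X ◁ ⟦braid Y T⟧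
  :> hom (X ⊗ (Y ⊗ (T ⊗ R))) _.
Proof.
rewrite -(@braid_tensl (leaf_word X) (leaf_word Y) (leaf_word T)).
exact: (@braid_natl (tens_word (leaf_word X) (leaf_word Y)) (leaf_word Z)
  (leaf_word T) f R).
Qed.

Lemma braid_mulr (f : hom (X ⊗ Y) Z) :
  ⟦braid T Z⟧ ∘ T ◁ ⟦f⟧ = ⟦f⟧ ∘ X ◁ ⟦braid T Y⟧ ∘ ⟦braid T X⟧
  :> hom (T ⊗ (X ⊗ (Y ⊗ R))) _.
Proof.
rewrite -(@braid_tensr (leaf_word T) (leaf_word X) (leaf_word Y)).
exact: (@braid_natr (leaf_word T) (tens_word (leaf_word X) (leaf_word Y))
  (leaf_word Z) f R).
Qed.

Lemma braid_comulr (d : hom X (Y ⊗ Z)) :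
  Y ◁ ⟦braid T Z⟧ ∘ ⟦braid T Y⟧ ∘ T ◁ ⟦d⟧ = ⟦d⟧ ∘ ⟦braid T X⟧
  :> hom (T ⊗ (X ⊗ R)) _.
Proof.
rewrite comp_assoc -(@braid_tensr (leaf_word T) (leaf_word Y) (leaf_word Z)).
exact: (@braid_natr (leaf_word T) (leaf_word X)
  (tens_word (leaf_word Y) (leaf_word Z)) d R).
Qed.

Lemma braid_onel (u : hom munit X) :
  ⟦braid X T⟧ ∘ ⟦u⟧ = T ◁ ⟦u⟧ :> hom (T ⊗ R) _.
Proof.
rewrite -[RHS]comp_idr -(braid_unitl (leaf_word T)).
exact: (@braid_natl (munit_word C) (leaf_word X) (leaf_word T) u R).
Qed.

Lemma braid_oner (u : hom munit X) :
  ⟦braid T X⟧ ∘ T ◁ ⟦u⟧ = ⟦u⟧ :> hom (T ⊗ R) _.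
Proof.
rewrite -[RHS]comp_idr -(braid_unitr (leaf_word T)).
exact: (@braid_natr (leaf_word T) (munit_word C) (leaf_word X) u R).
Qed.

End OnLetters.

Lemma mid_braid_nat (X X' Y Y' Z Z' T T' : C) (f : hom X X') (g : hom Y Y')
    (h : hom Z Z') (l : hom T T') :
  mid_braid X' Y' Z' T' ∘ ((f ⊠ g) ⊠ (h ⊠ l))
  = ((f ⊠ h) ⊠ (g ⊠ l)) ∘ mid_braid X Y Z T.
Proof.
have associ_nat (P P' Q Q' R R' : C) (p : hom P P') (q : hom Q Q')
    (r : hom R R') :
    associ P' Q' R' ∘ (p ⊠ (q ⊠ r)) = ((p ⊠ q) ⊠ r) ∘ associ P Q R.
  apply: (iso_mono (assoc_iso _ _ _)); rewrite comp_assoc.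
  rewrite (proj2 (assoc_iso _ _ _)) comp_idl comp_assoc assoc_nat -comp_assoc.
  by rewrite (proj2 (assoc_iso _ _ _)) comp_idr.
rewrite /mid_braid -!comp_assoc assoc_nat !comp_assoc -associ_nat -!comp_assoc.
congr (_ ∘ _); rewrite !comp_assoc; congr (_ ∘ _).
rewrite -!tensm_comp !comp_idl !comp_idr -!comp_assoc associ_nat.
rewrite (comp_assoc (braid Y' Z' ⊠ _)) -tensm_comp comp_idl braid_nat.
by rewrite -[l]comp_idr tensm_comp !comp_assoc assoc_nat comp_idr.
Qed.

End Braiding.

(** * The monoidal category of right modules over a bialgebra *)

Section Modules.
Variables (k : fieldType) (C : braidedCategory k) (B : bialgebra C).
Implicit Types X Y Z R : C.
Notation m := (bi_mul B).
Notation D := (bi_comul B).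
Notation u := (bi_unit B).
Notation Ψ X Y := (tail (braid (X : C) (Y : C)) _).

Lemma strict_coassoc R : B ◁ ⟦D⟧ ∘ ⟦D⟧ = ⟦D⟧ ∘ ⟦D⟧ :> hom (B ⊗ R) _.
Proof.
by have /(congr1 (fun f => tail f R)) := coalg_coassoc (bi_coalg B); strictify.
Qed.

Lemma strict_comul_mul R :
  ⟦D⟧ ∘ ⟦m⟧ = B ◁ ⟦m⟧ ∘ ⟦m⟧ ∘ B ◁ Ψ B B ∘ B ◁ B ◁ ⟦D⟧ ∘ ⟦D⟧
  :> hom (B ⊗ (B ⊗ R)) _.
Proof.
have /(congr1 (fun f => tail f R)) := bi_comul_mul B.
by strictify; rewrite -!comp_assoc.
Qed.

Lemma strict_comul_one R : ⟦D⟧ ∘ ⟦u⟧ = B ◁ ⟦u⟧ ∘ ⟦u⟧ :> hom R _.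
Proof.
by have /(congr1 (fun f => tail f R)) := bi_comul_unit B; strictify.
Qed.

Lemma strict_act_mul X (b : hom (X ⊗ B) X) R : is_right_module b ->
  ⟦b⟧ ∘ X ◁ ⟦m⟧ = ⟦b⟧ ∘ ⟦b⟧ :> hom (X ⊗ (B ⊗ (B ⊗ R))) _.
Proof. by move=> [/(congr1 (fun f => tail f R)) + _]; strictify => ->. Qed.

Lemma strict_act_one X (b : hom (X ⊗ B) X) R : is_right_module b ->
  ⟦b⟧ ∘ X ◁ ⟦u⟧ = idm (X ⊗ R).
Proof. by move=> [_ /(congr1 (fun f => tail f R))]; strictify. Qed.

(** Acting by b and then by c, or by their product, both lead to
    (x b_(1)) c_(1) ⊗ (y b_(2)) c_(2), by multiplicativity of the comultiplication
    and naturality of the braiding. *)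
Lemma tensor_action_module X Y (bX : hom (X ⊗ B) X) (bY : hom (Y ⊗ B) Y) :
  is_right_module bX -> is_right_module bY ->
  is_right_module (tensor_action bX bY).
Proof.
move=> modX modY; split; apply: tail_faithful => R; strictify.
  redraw (X ◁ ⟦bY⟧ ∘ ⟦bX⟧ ∘ X ◁ ((Ψ Y B ∘ ⟦bY⟧) ∘ Y ◁ B ◁ ⟦D⟧)
    ∘ ⟦bX⟧ ∘ X ◁ (Ψ Y B ∘ Y ◁ ⟦D⟧)).
  rewrite braid_mull.
  redraw (X ◁ (⟦bY⟧ ∘ ⟦bY⟧) ∘ (⟦bX⟧ ∘ ⟦bX⟧) ∘ X ◁ (B ◁ Ψ Y B ∘ Ψ Y B
    ∘ Y ◁ B ◁ Ψ B B ∘ Y ◁ (B ◁ B ◁ ⟦D⟧ ∘ ⟦D⟧))).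
  rewrite -!strict_act_mul //.
  redraw (X ◁ ⟦bY⟧ ∘ ⟦bX⟧ ∘ X ◁ (B ◁ Y ◁ ⟦m⟧
    ∘ (⟦m⟧ ∘ B ◁ Ψ Y B ∘ Ψ Y B)
    ∘ Y ◁ B ◁ Ψ B B ∘ Y ◁ (B ◁ B ◁ ⟦D⟧ ∘ ⟦D⟧))).
  by rewrite -braid_mulr; interchange; rewrite strict_comul_mul; interchange.
redraw (X ◁ ⟦bY⟧ ∘ ⟦bX⟧ ∘ X ◁ (Ψ Y B ∘ Y ◁ (⟦D⟧ ∘ ⟦u⟧))).
rewrite strict_comul_one.
redraw (X ◁ (⟦bY⟧ ∘ Y ◁ ⟦u⟧) ∘ ⟦bX⟧ ∘ X ◁ (Ψ Y B ∘ Y ◁ ⟦u⟧)).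
by rewrite braid_oner !strict_act_one // lwhisk_id comp_idl.
Qed.

Lemma morphism_id X (bX : hom (X ⊗ B) X) :
  is_right_module_morphism bX bX (idm X).
Proof. by rewrite /is_right_module_morphism tensm_id comp_idl comp_idr. Qed.

Lemma morphism_comp X Y Z (bX : hom (X ⊗ B) X) (bY : hom (Y ⊗ B) Y)
    (bZ : hom (Z ⊗ B) Z) (g : hom Y Z) (f : hom X Y) :
  is_right_module_morphism bY bZ g -> is_right_module_morphism bX bY f ->
  is_right_module_morphism bX bZ (g ∘ f).
Proof.
rewrite /is_right_module_morphism => gB fB.
by rewrite -[idm B]comp_idl tensm_comp comp_assoc gB -comp_assoc fB comp_assoc.
Qed.

Lemma morphism_inv X Y (bX : hom (X ⊗ B) X) (bY : hom (Y ⊗ B) Y) f fi :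
  inverse_isos f fi -> is_right_module_morphism bX bY f ->
  is_right_module_morphism bY bX fi.
Proof.
rewrite /is_right_module_morphism => isof fB; apply: (iso_mono isof).
rewrite !comp_assoc -fB (proj2 isof) comp_idl -comp_assoc -tensm_comp.
by rewrite (proj2 isof) comp_idl tensm_id comp_idr.
Qed.

Lemma morphism_tens X X' Y Y' (bX : hom (X ⊗ B) X) (bX' : hom (X' ⊗ B) X')
    (bY : hom (Y ⊗ B) Y) (bY' : hom (Y' ⊗ B) Y') f g :
  is_right_module_morphism bX bX' f -> is_right_module_morphism bY bY' g ->
  is_right_module_morphism (tensor_action bX bY) (tensor_action bX' bY')
    (f ⊠ g).
Proof.
rewrite /is_right_module_morphism /tensor_action => fB gB.
have -> : f ⊠ g ∘ (bX ⊠ bY) ∘ mid_braid X Y B B ∘ (idm (X ⊗ Y) ⊠ D)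
  = (bX' ⊠ bY') ∘ (mid_braid X' Y' B B ∘ ((f ⊠ g) ⊠ (idm B ⊠ idm B)))
    ∘ (idm (X ⊗ Y) ⊠ D).
  by rewrite mid_braid_nat !comp_assoc -!tensm_comp fB gB.
rewrite -(comp_assoc (mid_braid _ _ _ _)) -(comp_assoc (bX' ⊠ bY')).
rewrite -(comp_assoc (mid_braid _ _ _ _)) tensm_id -!tensm_comp.
by rewrite !comp_idl !comp_idr.
Qed.

(** The two actions of c send x ⊗ y ⊗ z to x c_(1) ⊗ y c_(2) ⊗ z c_(3); they differ
    in how the threefold comultiplication of c is formed. *)
Lemma morphism_assoc X Y Z (bX : hom (X ⊗ B) X) (bY : hom (Y ⊗ B) Y)
    (bZ : hom (Z ⊗ B) Z) :
  is_right_module_morphism (tensor_action (tensor_action bX bY) bZ)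
    (tensor_action bX (tensor_action bY bZ)) (assoc X Y Z).
Proof.
apply: tail_faithful => R; strictify.
rewrite (@braid_tensl _ _ (leaf_word Y) (leaf_word Z) (leaf_word B)).
redraw (X ◁ Y ◁ ⟦bZ⟧ ∘ X ◁ ⟦bY⟧ ∘ ⟦bX⟧ ∘ X ◁ Ψ Y B
  ∘ X ◁ Y ◁ (B ◁ Ψ Z B ∘ Ψ Z B ∘ Z ◁ (B ◁ ⟦D⟧ ∘ ⟦D⟧))).
rewrite strict_coassoc.
redraw (X ◁ Y ◁ ⟦bZ⟧ ∘ X ◁ ⟦bY⟧ ∘ ⟦bX⟧ ∘ X ◁ Ψ Y B
  ∘ X ◁ Y ◁ ((B ◁ Ψ Z B ∘ Ψ Z B ∘ Z ◁ ⟦D⟧) ∘ Z ◁ ⟦D⟧)).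
by rewrite braid_comulr; interchange.
Qed.

End Modules.

(** * Modules over an algebra along an entwining *)

Section Entwining.
Variables (k : fieldType) (C : monoidalCategory k) (A V : C).
Variables (m : hom (A ⊗ A) A) (u : hom munit A) (psi : hom (A ⊗ V) (V ⊗ A)).

(** The two conditions on the algebra A in an entwining structure; they say that psi
    is a distributive law of A over the object V. *)
Record is_entwining : Prop := IsEntwining {
  entwining_mul : psi ∘ (m ⊠ idm V) =
    (idm V ⊠ m) ∘ assoc V A A ∘ (psi ⊠ idm A) ∘ associ A V A
    ∘ (idm A ⊠ psi) ∘ assoc A A V;
  entwining_unit : psi ∘ (u ⊠ idm V) = (idm V ⊠ u) ∘ runiti V ∘ lunit V
}.

Definition lact_along (W : C) (a : hom (A ⊗ W) W) :
    hom (A ⊗ (V ⊗ W)) (V ⊗ W) :=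
  (idm V ⊠ a) ∘ assoc V A W ∘ (psi ⊠ idm W) ∘ associ A V W.

(** Moving a product of A across V by psi is moving its factors one by one, so
    associativity and unitality of a carry over to V ⊗ W. *)
Lemma lact_along_module (W : C) (a : hom (A ⊗ W) W) :
  is_entwining -> is_left_module m u a -> is_left_module m u (lact_along a).
Proof.
move=> [psi_m psi_u] [a_m a_u]; rewrite /lact_along.
split; apply: tail_faithful => R; strictify.
  have strict_m R' : ⟦psi⟧ ∘ ⟦m⟧ = V ◁ ⟦m⟧ ∘ ⟦psi⟧ ∘ A ◁ ⟦psi⟧
      :> hom (A ⊗ (A ⊗ (V ⊗ R'))) _.
    by move/(congr1 (fun f => tail f R')): psi_m; strictify.
  have strict_a : ⟦a⟧ ∘ ⟦m⟧ = ⟦a⟧ ∘ A ◁ ⟦a⟧ :> hom (A ⊗ (A ⊗ (W ⊗ R))) _.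
    by move/(congr1 (fun f => tail f R)): a_m; strictify.
  redraw (V ◁ ⟦a⟧ ∘ ⟦psi⟧ ∘ ⟦m⟧); rewrite strict_m.
  redraw (V ◁ (⟦a⟧ ∘ ⟦m⟧) ∘ ⟦psi⟧ ∘ A ◁ ⟦psi⟧).
  by rewrite strict_a; interchange.
have strict_u R' : ⟦psi⟧ ∘ ⟦u⟧ = V ◁ ⟦u⟧ :> hom (V ⊗ R') _.
  by move/(congr1 (fun f => tail f R')): psi_u; strictify.
have strict_au : ⟦a⟧ ∘ ⟦u⟧ = idm (W ⊗ R).
  by move/(congr1 (fun f => tail f R)): a_u; strictify.
interchange; rewrite strict_u.
by interchange; rewrite strict_au lwhisk_id.
Qed.

End Entwining.

(** * The entwining given by a coaction *)

Section CoactSwap.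
Variables (k : fieldType) (C : braidedCategory k) (B : bialgebra C).
Notation m := (bi_mul B).
Notation D := (bi_comul B).
Notation Ψ X Y := (tail (braid (X : C) (Y : C)) _).

(** a ⊗ v |-> v_(0) ⊗ a · v_(1) *)
Definition coact_swap (A V : C) (b : hom (A ⊗ B) A) (d : hom V (V ⊗ B)) :
    hom (A ⊗ V) (V ⊗ A) :=
  (idm V ⊠ b) ∘ assoc V A B ∘ (braid A V ⊠ idm B) ∘ associ A V B ∘ (idm A ⊠ d).

Lemma strict_coact (V : C) (d : hom V (V ⊗ B)) R : is_right_comodule d ->
  V ◁ ⟦D⟧ ∘ ⟦d⟧ = ⟦d⟧ ∘ ⟦d⟧ :> hom (V ⊗ R) _.
Proof. by move=> [/(congr1 (fun f => tail f R)) + _]; strictify. Qed.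

Lemma strict_coact_counit (V : C) (d : hom V (V ⊗ B)) R : is_right_comodule d ->
  V ◁ ⟦bi_counit B⟧ ∘ ⟦d⟧ = idm (V ⊗ R).
Proof. by move=> [_ /(congr1 (fun f => tail f R))]; strictify. Qed.

(** For the product: (a a') · v_(1) is (a · v_(1)) (a' · v_(2)) as A is a module
    algebra, and by coassociativity v_(1) and v_(2) come from coacting on v twice,
    which is what happens when a' and a cross V one after the other. *)
Lemma coact_swap_entwining (A : moduleAlgebra B) (V : C) (d : hom V (V ⊗ B)) :
  is_right_comodule d ->
  is_entwining (ma_mul A) (ma_unit A) (coact_swap (ma_act A) d).
Proof.
move=> comod; rewrite /coact_swap.
set b := ma_act A; set mA := ma_mul A; set uA := ma_unit A.
split; apply: tail_faithful => R; strictify.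
  have strict_b R' : ⟦b⟧ ∘ ⟦mA⟧ =
      ⟦mA⟧ ∘ A ◁ ⟦b⟧ ∘ ⟦b⟧ ∘ A ◁ (Ψ A B ∘ A ◁ ⟦D⟧)
      :> hom (A ⊗ (A ⊗ (B ⊗ R'))) _.
    have /(congr1 (fun f => tail f R')) := ma_act_mul A.
    by strictify => ->; interchange.
  redraw (V ◁ ⟦b⟧ ∘ (Ψ A V ∘ ⟦mA⟧) ∘ A ◁ A ◁ ⟦d⟧).
  rewrite braid_mull.
  redraw (V ◁ (⟦b⟧ ∘ ⟦mA⟧) ∘ Ψ A V ∘ A ◁ Ψ A V ∘ A ◁ A ◁ ⟦d⟧).
  rewrite strict_b.
  redraw (V ◁ (⟦mA⟧ ∘ ⟦b⟧ ∘ A ◁ (B ◁ ⟦b⟧ ∘ Ψ A B))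
    ∘ Ψ A V ∘ A ◁ Ψ A V ∘ A ◁ A ◁ (V ◁ ⟦D⟧ ∘ ⟦d⟧)).
  rewrite strict_coact //.
  redraw (V ◁ ⟦mA⟧ ∘ V ◁ ⟦b⟧ ∘ Ψ A V ∘ A ◁ (V ◁ B ◁ ⟦b⟧
    ∘ (V ◁ Ψ A B ∘ Ψ A V ∘ A ◁ ⟦d⟧) ∘ A ◁ ⟦d⟧)).
  by rewrite braid_comulr; interchange.
have strict_b1 R' : ⟦b⟧ ∘ ⟦uA⟧ = ⟦uA⟧ ∘ ⟦bi_counit B⟧ :> hom (B ⊗ R') _.
  by have /(congr1 (fun f => tail f R')) := ma_act_unit A; strictify.
redraw (V ◁ ⟦b⟧ ∘ (Ψ A V ∘ ⟦uA⟧) ∘ ⟦d⟧).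
rewrite braid_onel merge_comp strict_b1 lwhisk_comp -comp_assoc.
by rewrite strict_coact_counit // comp_idr.
Qed.

(** Starting from the composite that swaps first, the B-actions on A are collected
    and turned into one action of a product in B; what is left beside Ψ A V and
    that action is one side of the Yetter-Drinfeld condition, and the same steps
    backwards lead to the composite that swaps last. *)
Lemma coact_swap_morphism (A : C) (b : hom (A ⊗ B) A)
    (V : yetterDrinfeldModule B) :
  is_right_module b ->
  is_right_module_morphism (tensor_action b (yd_act V))
    (tensor_action (yd_act V) b) (coact_swap b (yd_coact V)).
Proof.
move=> modA; rewrite /coact_swap; set bV := yd_act V; set d := yd_coact V.
apply: tail_faithful => R; strictify.
have yd : V ◁ ⟦m⟧ ∘ ⟦bV⟧ ∘ V ◁ Ψ B B ∘ V ◁ B ◁ ⟦D⟧ ∘ ⟦d⟧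
    = V ◁ ⟦m⟧ ∘ Ψ B V ∘ B ◁ (⟦d⟧ ∘ ⟦bV⟧) ∘ Ψ V B ∘ V ◁ ⟦D⟧
    :> hom (V ⊗ (B ⊗ R)) _.
  have /(congr1 (fun f => tail f R)) := yd_compat V; strictify.
  by rewrite -!comp_assoc lwhisk_comp -!comp_assoc.
redraw (V ◁ ⟦b⟧ ∘ ⟦bV⟧ ∘ V ◁ ((Ψ A B ∘ ⟦b⟧) ∘ A ◁ B ◁ ⟦D⟧)
  ∘ Ψ A V ∘ A ◁ ⟦d⟧).
rewrite braid_mull.
redraw (V ◁ (⟦b⟧ ∘ ⟦b⟧) ∘ (⟦bV⟧ ∘ V ◁ Ψ A B ∘ Ψ A V)
  ∘ A ◁ (V ◁ Ψ B B ∘ V ◁ B ◁ ⟦D⟧ ∘ ⟦d⟧)).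
rewrite -braid_mulr -strict_act_mul //.
redraw (V ◁ ⟦b⟧ ∘ Ψ A V
  ∘ A ◁ (V ◁ ⟦m⟧ ∘ ⟦bV⟧ ∘ V ◁ Ψ B B ∘ V ◁ B ◁ ⟦D⟧ ∘ ⟦d⟧)).
rewrite yd.
redraw (V ◁ (⟦b⟧ ∘ A ◁ ⟦m⟧) ∘ Ψ A V
  ∘ A ◁ (Ψ B V ∘ B ◁ (⟦d⟧ ∘ ⟦bV⟧) ∘ Ψ V B ∘ V ◁ ⟦D⟧)).
rewrite strict_act_mul //.
redraw (V ◁ ⟦b⟧ ∘ (V ◁ ⟦b⟧ ∘ Ψ A V ∘ A ◁ Ψ B V)
  ∘ A ◁ (B ◁ (⟦d⟧ ∘ ⟦bV⟧) ∘ Ψ V B ∘ V ◁ ⟦D⟧)).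
by rewrite -braid_mull; interchange.
Qed.

End CoactSwap.

Theorem theorem2p4 (k : fieldType) (C : braidedCategory k) (B : bialgebra C)
    (A : moduleAlgebra B) (V : yetterDrinfeldModule B) (W : AModModB A) :
  is_AModModB (A := A) (W := V ⊗ W) (triangle_lact V W) (triangle_ract V W).
Proof.
set psi := coact_swap (ma_act A) (yd_coact V).
have lactE : triangle_lact V W = lact_along psi (amb_lact W).
  rewrite /triangle_lact /lact_along /psi /coact_swap.
  by apply: tail_faithful => R; strictify; interchange.
rewrite -[triangle_ract V W]/(tensor_action (yd_act V) (amb_ract W)) lactE.
have [lmodW rmodW compatW] := amb_ax W.
split.
- exact: lact_along_module (coact_swap_entwining _ (yd_comod V)) lmodW.
- exact: tensor_action_module (yd_mod V) rmodW.
apply: morphism_comp (morphism_tens (morphism_id _) compatW) _.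
apply: morphism_comp (morphism_assoc _ _ _) _.
apply: morphism_comp (morphism_tens _ (morphism_id _)) _.
  exact: coact_swap_morphism (ma_mod A).
exact: morphism_inv (assoc_iso _ _ _) (morphism_assoc _ _ _).
Qed.
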